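(* Let $\alpha,\beta,\delta\in\mathbb{R}$ with $\beta\neq 0$, and let $\mathcal{K}_G$ be the Green's operator of the general self-adjoint real-coupled boundary value problem on $[0,1]$ with boundary conditions $$u'(0)=\alpha u(0)+\beta u(1),\qquad u'(1)=-\beta u(0)+\delta u(1).$$ Then $\mathcal{K}_G$ is a finite rank perturbation of $\mathcal{K}$, with polynomial kernel and of rank at most $4$: the operator $\mathcal{T}=\mathcal{K}-\mathcal{K}_G$ is an integral operator on $L^2(0,1)$ whose kernel is a polynomial in $(x,y)$, and $\operatorname{rank}\mathcal{T}\le 4$.
   Context: $\mathcal{K}$ is the integral operator on $L^2(0,1)$ given by $\mathcal{K}f(x)=-\frac12\int_0^1|x-y|\,f(y)\,dy$. $A$ denotes the self-adjoint operator $-\frac{d^2}{dx^2}$ on $L^2(0,1)$ with domain the functions in $H^2(0,1)$ satisfying the stated boundary conditions; it has discrete spectrum. $P$ denotes the orthogonal projection onto $\ker A$ ($P=0$ if $0$ is not an eigenvalue). The Green's operator $\mathcal{K}_G$ is the bounded operator $S$ on $L^2(0,1)$ determined by $AS=I-P$ and $SP=PS=0$ (so $\mathcal{K}_G=A^{-1}$ when $0$ is not an eigenvalue); equivalently $S=\frac{1}{2\pi i}\oint z^{-1}(A-zI)^{-1}\,dz$ over a small positively oriented circle around $0$ enclosing no nonzero eigenvalue of $A$. It is an integral operator, $\mathcal{K}_Gf(x)=\int_0^1G_0(x,y)f(y)\,dy$, with $G_0$ the Green's function. *)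

(* Defs.v *)
From mathcomp Require Import all_boot all_order all_algebra polyXY.
From mathcomp Require Import complex.
From mathcomp Require Import all_classical all_reals all_analysis.

Set Implicit Arguments.
Unset Strict Implicit.
Unset Printing Implicit Defensive.

Import Order.TTheory GRing.Theory Num.Theory.
Import numFieldNormedType.Exports.

Local Open Scope classical_set_scope.
Local Open Scope complex_scope.
Local Open Scope ring_scope.

(* The complex Hilbert space L^2(0,1) is handled through representatives: an
   element is a function R -> R[i] satisfying [L2], only its values on [0, 1]
   matter, and equality of elements is [eqL2].  An operator acts on
   representatives.  The endpoints are Lebesgue-null, so [0, 1] stands for
   (0, 1). *)
Section GreenOperator.
Context {R : realType}.
Local Notation C := R[i].
Local Notation mu := (@lebesgue_measure R).
Local Notation I01 := (`[(0 : R), (1 : R)]%classic).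
Implicit Types (f g h u v : R -> C) (S P T : (R -> C) -> (R -> C)).

Definition L2 f : Prop :=
  [/\ measurable_fun I01 (fun x => complex.Re (f x)),
      measurable_fun I01 (fun x => complex.Im (f x)) &
      mu.-integrable I01 (fun x => (Normc.normc (f x) ^+ 2)%:E)].

Definition eqL2 f g : Prop := ae_eq mu I01 f g.

Definition cintegral (D : set R) f : C :=
  (\int[mu]_(x in D) complex.Re (f x)) +i*
  (\int[mu]_(x in D) complex.Im (f x)).

Definition inner f g : C := cintegral I01 (fun x => f x * conjc (g x)).

Definition normL2 f : R :=
  Num.sqrt (\int[mu]_(x in I01) (Normc.normc (f x) ^+ 2)).

Definition bounded_operator T : Prop :=
  [/\ forall f, L2 f -> L2 (T f),
      forall f g, L2 f -> L2 g -> eqL2 f g -> eqL2 (T f) (T g),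
      forall (c : C) f g, L2 f -> L2 g ->
        eqL2 (T (fun x => c * f x + g x)) (fun x => c * T f x + T g x) &
      exists M : R, forall f, L2 f -> normL2 (T f) <= M * normL2 f].

Definition integral_operator (k : R -> R -> C) T : Prop :=
  forall f, L2 f ->
    eqL2 (T f) (fun x => cintegral I01 (fun y => k x y * f y)).

Definition polynomial_kernel (k : R -> R -> C) : Prop :=
  exists p : {poly {poly C}}, forall x y : R, k x y = p.[x%:C, y%:C].

(* dim (range T) <= n: the range lies in the span of n vectors of L^2(0,1). *)
Definition rank_le T (n : nat) : Prop :=
  exists h : 'I_n -> R -> C,
    (forall i, L2 (h i)) /\
    forall f, L2 f ->
      exists c : 'I_n -> C, eqL2 (T f) (fun x => \sum_(i < n) c i * h i x).

Definition calK f : R -> C :=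
  fun x => - 2^-1 * cintegral I01 (fun y => `|x - y|%:C * f y).

(* [u] is the C^1 representative on [0, 1] of an element of H^2(0,1), with
   first derivative [u1] and second (weak) derivative [u2]: [u] and [u1] are
   absolutely continuous, written as indefinite integrals, and [u2] is in
   L^2(0,1). *)
Definition H2_rep u (u1 u2 : R -> C) : Prop :=
  L2 u2 /\
  forall x : R, 0 <= x <= 1 ->
    u x = u 0 + cintegral `[0, x] u1 /\ u1 x = u1 0 + cintegral `[0, x] u2.

Definition boundary_conditions (alpha beta delta : R) u (u1 : R -> C) : Prop :=
  u1 0 = alpha%:C * u 0 + beta%:C * u 1 /\
  u1 1 = - beta%:C * u 0 + delta%:C * u 1.

(* The graph of A: [u] belongs to the domain of A = - d^2/dx^2 and A u = g. *)
Definition graphA (alpha beta delta : R) u g : Prop :=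
  [/\ L2 u, L2 g &
      exists v v1 v2 : R -> C,
        [/\ H2_rep v v1 v2, boundary_conditions alpha beta delta v v1,
            eqL2 u v & eqL2 g (fun x => - v2 x)]].

Definition kerA (alpha beta delta : R) u : Prop :=
  graphA alpha beta delta u (fun=> 0).

Definition orthogonal_projection (V : (R -> C) -> Prop) P : Prop :=
  forall f, L2 f ->
    V (P f) /\ forall v, V v -> inner (fun x => f x - P f x) v = 0.

(* A S = I - P and S P = P S = 0, with P the orthogonal projection onto
   ker A; this determines S up to almost-everywhere equality. *)
Definition green_operator (alpha beta delta : R) S : Prop :=
  bounded_operator S /\
  exists P,
    orthogonal_projection (kerA alpha beta delta) P /\
    forall f, L2 f ->
      [/\ graphA alpha beta delta (S f) (fun x => f x - P f x),
          eqL2 (S (P f)) (fun=> 0) &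
          eqL2 (P (S f)) (fun=> 0)].

End GreenOperator.

(* Main.v *)
Require Import Defs.
From mathcomp Require Import all_boot all_order all_algebra complex.
From mathcomp Require Import ring lra.
From mathcomp Require Import all_classical all_reals all_analysis.
From mathcomp Require Import measurable_realfun.

(** The idea is that T = K - S, where K is [calK] and S the Green's operator,
    is a symmetric operator that maps every f to a cubic polynomial, and that
    such an operator has a polynomial kernel.

    T f is a cubic: -(K f)'' = f, and S f is a function u with
    -u'' = f - P f, so (T f)'' = - P f.  Elements of ker A solve v'' = 0, so
    P f is affine, and integrating twice gives a polynomial of degree at most 3
    ([kerA_affine], [graphA_sub_poly], [perturbation_cubic]).  This already
    bounds the rank by 4.

    T is symmetric: Green's identity ([green_identity]) makes every realization
    of -d^2/dx^2 under these coupled boundary conditions symmetric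
    ([graphA_symmetric]).  This gives the symmetry of S, because the range of S
    is orthogonal to ker A.  It gives that of K too, because K inverts the
    realization with alpha = beta = -1 and delta = 1 ([graphA_calK]).

    The kernel: let d_0, ..., d_3 be the cubics with <x^k, d_i> = 1 if i = k and
    0 otherwise ([inner_dual_monomial]).  The i-th coefficient of the cubic T f
    is <T f, d_i> = <f, T d_i>, and q_i = T d_i is a cubic, so T has the kernel
    sum_i x^i conj (q_i y).

    Green's identity is needed for functions whose derivatives are only
    absolutely continuous.  The integration by parts behind it is Fubini's
    theorem for f y * g x on the two halves y <= x and x < y of the unit square
    ([integral_section_split], [primitive_by_parts]). *)

Local Open Scope ring_scope.

Section Proofs.
Import Order.TTheory GRing.Theory Num.Theory.
Import numFieldNormedType.Exports.
Local Open Scope classical_set_scope.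
Local Open Scope complex_scope.

(** * Splitting a product integral along a relation *)

Section SplitProduct.
Context {d} {T : measurableType d} {R : realType}.
Variable m : {sigma_finite_measure set T -> \bar R}.
Implicit Types (f g : T -> R) (b : T * T -> bool).

Lemma integrable_measurable f :
  m.-integrable setT (EFin \o f) -> measurable_fun setT f.
Proof. by move=> /integrableP[/measurable_EFinP]. Qed.

Lemma integrable_prod f g :
  m.-integrable setT (EFin \o f) -> m.-integrable setT (EFin \o g) ->
  (m \x m)%E.-integrable setT (fun z : T * T => (f z.2 * g z.1)%:E).
Proof.
move=> fi gi.
have mf := integrable_measurable _ fi.
have mg := integrable_measurable _ gi.
have mfg : measurable_fun setT (fun z : T * T => (f z.2 * g z.1)%:E).
  apply/measurable_EFinP; apply: measurable_funM.
    exact: (measurableT_comp mf).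
  exact: (measurableT_comp mg).
apply/(integrable12ltyP m m mfg).
case/integrableP: (fi) => _ fioo; case/integrableP: (gi) => mg' gioo.
have E x : (\int[m]_y `|(f y * g x)%:E| =
    `|(g x)%:E| * \int[m]_y `|(f y)%:E|)%E.
  rewrite -ge0_integralZl//.
  - by apply: eq_integral => y _; rewrite EFinM abseM muleC.
  - apply: measurableT_comp => //; exact/measurable_EFinP.
under eq_integral do rewrite /= E.
rewrite ge0_integralZr//.
- rewrite -ge0_fin_numE ?mule_ge0 ?integral_ge0//.
  by rewrite fin_numM// ge0_fin_numE// integral_ge0.
- by apply: measurableT_comp.
- exact: integral_ge0.
Qed.

Lemma measurable_boolR d' (S : measurableType d') (b : S -> bool) :
  measurable_fun setT b -> measurable_fun setT (fun z => (b z)%:R : R).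
Proof.
move=> mb; rewrite (_ : (fun z => (b z)%:R) = \1_(b @^-1` [set true]))%classic.
  apply: measurable_indic; rewrite -[X in measurable X]setTI.
  by apply: mb.
apply/funext => z; rewrite indicE; congr (nat_of_bool _)%:R.
by apply/idP/idP => [bz|]; [rewrite inE|rewrite inE].
Qed.

Lemma integrable_prod_bool f g b :
  measurable_fun setT b ->
  m.-integrable setT (EFin \o f) -> m.-integrable setT (EFin \o g) ->
  (m \x m)%E.-integrable setT (fun z : T * T => (f z.2 * g z.1 * (b z)%:R)%:E).
Proof.
move=> mb fi gi; have fgi := integrable_prod _ _ fi gi.
apply: (le_integrable measurableT _ _ fgi) => /=.
  apply/measurable_EFinP; apply: measurable_funM => //.
    by case/integrableP: fgi => /measurable_EFinP.
  exact: measurable_boolR.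
move=> x _; rewrite lee_fin normrM.
by case: (b x); rewrite /= ?normr1 ?normr0 ?mulr1 ?mulr0.
Qed.

Lemma integrable_bool f (b : T -> bool) :
  measurable_fun setT b -> m.-integrable setT (EFin \o f) ->
  m.-integrable setT (fun y => (f y * (b y)%:R)%:E).
Proof.
move=> mb fi; apply: (le_integrable measurableT _ _ fi) => /=.
  apply/measurable_EFinP/measurable_funM; first exact: integrable_measurable.
  exact: measurable_boolR.
move=> x _; rewrite lee_fin normrM.
by case: (b x); rewrite /= ?normr1 ?normr0 ?mulr1 ?mulr0.
Qed.

Lemma fubini_F_bool f g b x :
  measurable_fun setT b -> m.-integrable setT (EFin \o f) ->
  fubini_F m (fun z => (f z.2 * g z.1 * (b z)%:R)%:E) x =
  (\int[m]_y (f y * (b (x, y))%:R) * g x)%:E.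
Proof.
move=> mb fi; rewrite /fubini_F/=.
have fbi : m.-integrable setT (fun y => (f y * (b (x, y))%:R)%:E).
  apply: (integrable_bool _ (fun y => b (x, y))) => //.
  exact: (measurableT_comp mb).
under eq_integral do rewrite mulrAC EFinM.
by rewrite integralZr// EFinM /Rintegral fineK//; exact: integrable_fin_num.
Qed.

(** The sections of an integrable function on the product: this is how the
    product of a primitive with an integrable function is seen to be
    integrable, without continuity or bounds for the primitive. *)
Lemma integrable_section f g b :
  measurable_fun setT b ->
  m.-integrable setT (EFin \o f) -> m.-integrable setT (EFin \o g) ->
  m.-integrable setT
    (EFin \o (fun x => \int[m]_y (f y * (b (x, y))%:R) * g x)).
Proof.
move=> mb fi gi.
have := integrable_fubini_F (integrable_prod_bool _ _ _ mb fi gi).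
by apply: eq_integrable => // x _; exact: fubini_F_bool.
Qed.

(** The two iterated integrals are the double integrals of f y * g x over the
    region where [b] holds and over its complement, taken in opposite orders;
    together they cover the product. *)
Lemma integral_section_split f g b :
  measurable_fun setT b ->
  m.-integrable setT (EFin \o f) -> m.-integrable setT (EFin \o g) ->
  \int[m]_x (\int[m]_y (f y * (b (x, y))%:R) * g x) +
  \int[m]_y (\int[m]_x (g x * (~~ b (x, y))%:R) * f y) =
  \int[m]_x f x * \int[m]_x g x.
Proof.
move=> mb fi gi.
have mnb : measurable_fun setT (fun z => ~~ b z) by exact: measurable_neg.
have h1 := integrable_prod_bool _ _ _ mb fi gi.
have h2 := integrable_prod_bool _ _ _ mnb fi gi.
have E1 := integral12_prod_meas1 h1.
have E2 := integral21_prod_meas1 h2.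
rewrite (eq_integral _ _ (fun x _ => fubini_F_bool f g b x mb fi)) in E1.
have G2 y : fubini_G m (fun z => (f z.2 * g z.1 * (~~ b z)%:R)%:E) y =
    (\int[m]_x (g x * (~~ b (x, y))%:R) * f y)%:E.
  rewrite -(fubini_F_bool g f (fun z => ~~ b (z.2, z.1)))//.
    rewrite /fubini_F/fubini_G/=.
    by apply: eq_integral => x _; rewrite [f y * _]mulrC.
  apply: (measurableT_comp mnb); exact: measurable_fun_pair.
rewrite (eq_integral _ _ (fun x _ => G2 x)) in E2.
transitivity (fine (\int[(m \x m)%E]_z ((f z.2 * g z.1)%:E : \bar R))%E);
  last first.
  rewrite -(integral12_prod_meas1 (integrable_prod _ _ fi gi)) /fubini_F/=.
  under eq_integral do under eq_integral do rewrite EFinM.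
  under eq_integral do rewrite integralZr//.
  have ff : (\int[m]_y (f y)%:E)%E \is a fin_num by exact: integrable_fin_num.
  rewrite -(fineK ff) integralZl// fineM//; exact: integrable_fin_num.
have -> : (fun z : T * T => (f z.2 * g z.1)%:E) =
    (fun z => (f z.2 * g z.1 * (b z)%:R)%:E +
      (f z.2 * g z.1 * (~~ b z)%:R)%:E)%E.
  apply/funext => z; rewrite -EFinD; congr EFin.
  by case: (b z); rewrite mulr1 mulr0 ?addr0 ?add0r.
rewrite (integralD measurableT h1 h2) -E1 -E2 fineD//.
- by rewrite E1; exact: (integrable_fin_num measurableT h1).
- by rewrite E2; exact: (integrable_fin_num measurableT h2).
Qed.
End SplitProduct.

Context {R : realType}.
Local Notation C := R[i].
Local Notation mu := (@lebesgue_measure R).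
Local Notation I01 := (`[(0 : R), (1 : R)]%classic).

(** * Integration by parts for primitives on [0, 1] *)

Section RealPrimitives.
Implicit Types f g : R -> R.

Definition integrable01 f : Prop := mu.-integrable I01 (EFin \o f).

Definition primitive f (x : R) : R := \int[mu]_(y in `[0, x]) f y.

Lemma integrable01_measurable f : integrable01 f -> measurable_fun I01 f.
Proof. by move=> /integrableP[/measurable_EFinP]. Qed.

Lemma integrable01_restrict f :
  integrable01 f <-> mu.-integrable setT (EFin \o (f \_ I01)).
Proof. by rewrite -restrict_EFin -integrable_mkcond. Qed.

Lemma primitive_le f x : 0 <= x <= 1 ->
  \int[mu]_y ((f \_ I01) y * (y <= x)%R%:R) = primitive f x.
Proof.
move=> /andP[x0 x1]; rewrite /primitive [RHS]Rintegral_mkcond.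
apply: eq_Rintegral => y _ /=; rewrite /patch !mem_setE !in_itv/=.
have [yx|yx] := leP y x; last by rewrite mulr0 andbF.
by rewrite mulr1 (le_trans yx x1) andbT.
Qed.

Lemma primitive_lt f x : integrable01 f -> 0 <= x <= 1 ->
  \int[mu]_y ((f \_ I01) y * (y < x)%R%:R) = primitive f x.
Proof.
move=> fi /andP[x0 x1]; rewrite /primitive.
rewrite -Rintegral_itv_bndo_bndc; last first.
  apply: (integrableS _ _ _ fi) => //=.
  move=> y /=; rewrite !in_itv/= => /andP[-> /ltW yx]/=.
  by rewrite (le_trans yx).
rewrite [RHS]Rintegral_mkcond.
apply: eq_Rintegral => y _ /=; rewrite /patch !mem_setE !in_itv/=.
have [yx|yx] := ltP y x; last by rewrite mulr0 andbF.
by rewrite mulr1 (le_trans (ltW yx) x1) andbT.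
Qed.

Let leb : {sigma_finite_measure set (measurableTypeR R) -> \bar R} := mu.

Let le_pair (z : R * R) := z.2 <= z.1.

Let measurable_le_pair : measurable_fun setT le_pair.
Proof. exact: measurable_fun_ler. Qed.

(** Outside [0, 1] the restriction of [g] vanishes, so the section integral [c]
    has to be identified with the primitive on [0, 1] only. *)
Lemma restrict_sectionM f g (c x : R) :
  (0 <= x <= 1 -> c = primitive f x) ->
  c * (g \_ I01) x = ((fun x => primitive f x * g x) \_ I01) x.
Proof.
rewrite /patch mem_setE in_itv/=.
by case: ifPn => [x01 ->//|_ _]; rewrite mulr0.
Qed.

Lemma integrable01_primitiveM f g : integrable01 f -> integrable01 g ->
  integrable01 (fun x => primitive f x * g x).
Proof.
move=> /integrable01_restrict fi /integrable01_restrict gi.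
apply/integrable01_restrict.
have := integrable_section leb _ _ _ measurable_le_pair fi gi.
apply: eq_integrable => // x _ /=; congr EFin.
by apply: restrict_sectionM; exact: primitive_le.
Qed.

(** [integral_section_split] for the relation y <= x: the section integrals of
    the restrictions of [f] and [g] to [0, 1] are their primitives. *)
Lemma primitive_by_parts f g : integrable01 f -> integrable01 g ->
  \int[mu]_(x in I01) (primitive f x * g x) +
  \int[mu]_(x in I01) (primitive g x * f x) = primitive f 1 * primitive g 1.
Proof.
move=> fi0 gi0; have /integrable01_restrict fi := fi0.
have /integrable01_restrict gi := gi0.
have := integral_section_split leb _ _ _ measurable_le_pair fi gi.
rewrite /primitive !(Rintegral_mkcond mu I01) => <-; congr (_ + _).
  apply: eq_Rintegral => x _; apply/esym/restrict_sectionM.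
  exact: primitive_le.
apply: eq_Rintegral => x _; apply/esym/restrict_sectionM => x01.
by rewrite -primitive_lt//; under eq_Rintegral do rewrite /le_pair/= -ltNge.
Qed.

End RealPrimitives.

Implicit Types (f g h u v w : R -> C) (c : C) (a b x : R) (p q : {poly C}).

(** * Integrals of complex-valued functions *)

Lemma cReM (z w : C) : complex.Re (z * w) =
  complex.Re z * complex.Re w - complex.Im z * complex.Im w.
Proof. by case: z => ? ?; case: w => ? ?. Qed.

Lemma cImM (z w : C) : complex.Im (z * w) =
  complex.Re z * complex.Im w + complex.Im z * complex.Re w.
Proof. by case: z => ? ?; case: w => ? ?. Qed.

Lemma cReD (z w : C) : complex.Re (z + w) = complex.Re z + complex.Re w.
Proof. by case: z => ? ?; case: w => ? ?. Qed.

Lemma cImD (z w : C) : complex.Im (z + w) = complex.Im z + complex.Im w.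
Proof. by case: z => ? ?; case: w => ? ?. Qed.

Lemma cReJ (z : C) : complex.Re (z^*) = complex.Re z.
Proof. by case: z. Qed.

Lemma cImJ (z : C) : complex.Im (z^*) = - complex.Im z.
Proof. by case: z. Qed.

Definition cintegrable01 f : Prop :=
  integrable01 (fun x => complex.Re (f x)) /\
  integrable01 (fun x => complex.Im (f x)).

Lemma integrable01D (f g : R -> R) : integrable01 f -> integrable01 g ->
  integrable01 (fun x => f x + g x).
Proof. by move=> fi gi; exact: (integrableD _ fi gi). Qed.

Lemma integrable01Z a (f : R -> R) : integrable01 f ->
  integrable01 (fun x => a * f x).
Proof. by move=> fi; exact: (integrableZl _ _ fi). Qed.

Lemma integrable01N (f : R -> R) : integrable01 f ->
  integrable01 (fun x => - f x).
Proof. by move=> fi; exact: (integrableN fi). Qed.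

Lemma integrable01_cst a : integrable01 (fun=> a).
Proof.
apply: (@continuous_compact_integrable R (cst a)); first exact: segment_compact.
by apply: continuous_subspaceT => x; exact: cvg_cst.
Qed.

Lemma eq_integrable01 (f g : R -> R) :
  {in `[0, 1]%R, f =1 g} -> integrable01 f -> integrable01 g.
Proof.
move=> fg; apply: eq_integrable => // x; rewrite mem_setE => /fg /= ->//.
Qed.

Lemma integrable01_sub (f : R -> R) x : 0 <= x <= 1 ->
  integrable01 f -> mu.-integrable `[0, x] (EFin \o f).
Proof.
move=> /andP[x0 x1]; apply: integrableS => //.
by move=> y /=; rewrite !in_itv/= => /andP[-> yx]; exact: le_trans x1.
Qed.

Lemma eq_cintegrable01 f g :
  {in `[0, 1]%R, f =1 g} -> cintegrable01 f -> cintegrable01 g.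
Proof.
move=> fg [f1 f2]; split.
- by apply: eq_integrable01 f1 => x /fg ->.
- by apply: eq_integrable01 f2 => x /fg ->.
Qed.

Lemma cintegrable01_cst c : cintegrable01 (fun=> c).
Proof. by split; exact: integrable01_cst. Qed.

Lemma cintegrable01D f g : cintegrable01 f -> cintegrable01 g ->
  cintegrable01 (fun x => f x + g x).
Proof.
move=> [f1 f2] [g1 g2]; split.
- by apply: eq_integrable01 (integrable01D _ _ f1 g1) => x _; rewrite cReD.
- by apply: eq_integrable01 (integrable01D _ _ f2 g2) => x _; rewrite cImD.
Qed.

Lemma cintegrable01Z c f : cintegrable01 f -> cintegrable01 (fun x => c * f x).
Proof.
move=> [f1 f2]; split.
- apply: eq_integrable01 (integrable01D _ _
    (integrable01Z (complex.Re c) _ f1)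
    (integrable01N _ (integrable01Z (complex.Im c) _ f2))) => x _.
  by rewrite cReM.
- apply: eq_integrable01 (integrable01D _ _
    (integrable01Z (complex.Re c) _ f2)
    (integrable01Z (complex.Im c) _ f1)) => x _.
  by rewrite cImM.
Qed.

Lemma cintegrable01N f : cintegrable01 f -> cintegrable01 (fun x => - f x).
Proof.
move=> /(cintegrable01Z (-1)); apply: eq_cintegrable01 => x _.
by rewrite mulN1r.
Qed.

Lemma cintegrable01J f : cintegrable01 f -> cintegrable01 (fun x => (f x)^*).
Proof.
move=> [f1 f2]; split.
- by apply: eq_integrable01 f1 => x _; rewrite cReJ.
- by apply: eq_integrable01 (integrable01N _ f2) => x _; rewrite cImJ.
Qed.

Lemma eq_cintegral f g x : 0 <= x <= 1 -> {in `[0, 1]%R, f =1 g} ->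
  cintegral `[0, x] f = cintegral `[0, x] g.
Proof.
move=> /andP[x0 x1] fg.
have fg' y : y \in `[0, x]%classic -> f y = g y.
  rewrite mem_setE !in_itv/= => /andP[y0 yx].
  by rewrite fg// in_itv/= y0 (le_trans yx).
by congr (_ +i* _); apply: eq_Rintegral => y /fg' ->.
Qed.

Lemma cintegralD f g x : 0 <= x <= 1 -> cintegrable01 f -> cintegrable01 g ->
  cintegral `[0, x] (fun y => f y + g y) =
  cintegral `[0, x] f + cintegral `[0, x] g.
Proof.
move=> x01 [f1 f2] [g1 g2]; congr (_ +i* _); rewrite -RintegralD//;
  try exact: integrable01_sub.
- by apply: eq_Rintegral => y _; rewrite cReD.
- by apply: eq_Rintegral => y _; rewrite cImD.
Qed.

Lemma cintegralZ c f x : 0 <= x <= 1 -> cintegrable01 f ->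
  cintegral `[0, x] (fun y => c * f y) = c * cintegral `[0, x] f.
Proof.
move=> x01 [f1 f2]; rewrite /cintegral; case: c => c1 c2; congr (_ +i* _) => /=.
- rewrite -!RintegralZl -?RintegralB//;
    [|by apply: integrable01_sub => //; exact: integrable01Z
     |by apply: integrable01_sub => //; exact: integrable01Z
     |exact: integrable01_sub..].
  by apply: eq_Rintegral => y _; rewrite cReM.
- rewrite -!RintegralZl -?RintegralD//;
    [|by apply: integrable01_sub => //; exact: integrable01Z
     |by apply: integrable01_sub => //; exact: integrable01Z
     |exact: integrable01_sub..].
  by apply: eq_Rintegral => y _; rewrite cImM.
Qed.

Lemma cintegralN f x : 0 <= x <= 1 -> cintegrable01 f ->
  cintegral `[0, x] (fun y => - f y) = - cintegral `[0, x] f.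
Proof.
move=> x01 fi; rewrite -mulN1r -cintegralZ//.
by apply: eq_cintegral => // y _; rewrite mulN1r.
Qed.

Lemma cintegralJ f x : 0 <= x <= 1 -> cintegrable01 f ->
  cintegral `[0, x] (fun y => (f y)^*) = (cintegral `[0, x] f)^*.
Proof.
move=> x01 [f1 f2]; congr (_ +i* _).
  by apply: eq_Rintegral => y _; rewrite cReJ.
rewrite -mulN1r -RintegralZl//; last exact: integrable01_sub.
by apply: eq_Rintegral => y _; rewrite cImJ mulN1r.
Qed.

Lemma cintegral0 f : cintegral `[0, 0] f = 0.
Proof. by rewrite /cintegral set_itv1 !Rintegral_set1. Qed.

Lemma cintegral_cst c x : 0 <= x -> cintegral `[0, x] (fun=> c) = x%:C * c.
Proof.
move=> x0; rewrite /cintegral !Rintegral_cst//= lebesgue_measure_itv/=.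
rewrite lte_fin; case: (ltP 0 x) => [_|x0'].
  by rewrite -EFinB subr0/=; case: c => c1 c2; simpc; rewrite ![x * _]mulrC.
have -> : x = 0 by apply/eqP; rewrite eq_le x0 x0'.
by rewrite !mulr0 mul0r.
Qed.

Lemma ae_eq_cintegral f g x : 0 <= x <= 1 ->
  cintegrable01 f -> cintegrable01 g -> eqL2 f g ->
  cintegral `[0, x] f = cintegral `[0, x] g.
Proof.
move=> x01 [f1 f2] [g1 g2] fg.
have fg' : ae_eq mu `[0, x] f g.
  move/andP: x01 => [x0 x1]; apply: ae_eq_subset fg.
  by move=> y /=; rewrite !in_itv/= => /andP[-> yx]; exact: le_trans x1.
have m (h : R -> R) : integrable01 h -> measurable_fun `[0, x] (EFin \o h).
  by move=> /(integrable01_sub _ _ x01) /measurable_int.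
congr (_ +i* _); congr fine; apply: ae_eq_integral => //; do ?exact: m.
- exact: (ae_eq_comp (EFin \o @complex.Re R) fg').
- exact: (ae_eq_comp (EFin \o @complex.Im R) fg').
Qed.

Lemma cintegrable01_primitiveM f g : cintegrable01 f -> cintegrable01 g ->
  cintegrable01 (fun x => cintegral `[0, x] f * g x).
Proof.
move=> [f1 f2] [g1 g2]; split.
- apply: eq_integrable01 (integrable01D _ _
    (integrable01_primitiveM _ _ f1 g1)
    (integrable01N _ (integrable01_primitiveM _ _ f2 g2))) => x _.
  by rewrite cReM.
- apply: eq_integrable01 (integrable01D _ _
    (integrable01_primitiveM _ _ f1 g2)
    (integrable01_primitiveM _ _ f2 g1)) => x _.
  by rewrite cImM.
Qed.

(** Splits the complex integral into four real ones, to which the real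
    integration by parts applies. *)
Lemma cintegral_primitiveM f g : cintegrable01 f -> cintegrable01 g ->
  let fr y := complex.Re (f y) in let fi y := complex.Im (f y) in
  let gr y := complex.Re (g y) in let gi y := complex.Im (g y) in
  cintegral I01 (fun x => cintegral `[0, x] f * g x) =
    (\int[mu]_(x in I01) (primitive fr x * gr x) -
     \int[mu]_(x in I01) (primitive fi x * gi x)) +i*
    (\int[mu]_(x in I01) (primitive fr x * gi x) +
     \int[mu]_(x in I01) (primitive fi x * gr x)).
Proof.
move=> [f1 f2] [g1 g2] fr fi gr gi.
have p11 := integrable01_primitiveM _ _ f1 g1.
have p12 := integrable01_primitiveM _ _ f1 g2.
have p21 := integrable01_primitiveM _ _ f2 g1.
have p22 := integrable01_primitiveM _ _ f2 g2.
congr (_ +i* _); rewrite -?RintegralB -?RintegralD//.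
  by apply: eq_Rintegral => x _; rewrite cReM.
by apply: eq_Rintegral => x _; rewrite cImM.
Qed.

Lemma cintegral_primitive_by_parts f g : cintegrable01 f -> cintegrable01 g ->
  cintegral I01 (fun x => cintegral `[0, x] f * g x) +
  cintegral I01 (fun x => cintegral `[0, x] g * f x) =
  cintegral I01 f * cintegral I01 g.
Proof.
move=> fi gi; rewrite !cintegral_primitiveM//.
case: fi gi => [f1 f2] [g1 g2].
apply/eqP; rewrite eq_complex/=; apply/andP; split; apply/eqP.
  rewrite -[RHS]/(primitive _ 1 * primitive _ 1 -
    primitive _ 1 * primitive _ 1).
  by rewrite -!primitive_by_parts//; ring.
rewrite -[RHS]/(primitive _ 1 * primitive _ 1 +
  primitive _ 1 * primitive _ 1).
by rewrite -!primitive_by_parts//; ring.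
Qed.

(** * Square integrability *)

Lemma in01_1 : 0 <= (1 : R) <= 1.
Proof. by rewrite lexx ler01. Qed.

Lemma sqr_normcE (z : C) :
  Normc.normc z ^+ 2 = complex.Re z ^+ 2 + complex.Im z ^+ 2.
Proof. by case: z => p q /=; rewrite sqr_sqrtr ?addr_ge0 ?sqr_ge0. Qed.

Lemma L2_conj f : L2 f -> L2 (fun x => (f x)^*).
Proof.
move=> [m1 m2 i]; split.
- by rewrite (_ : (fun x => _) = (fun x => complex.Re (f x)))//;
    apply/funext => x; rewrite cReJ.
- rewrite (_ : (fun x => _) = (fun x => - complex.Im (f x))).
    exact: measurable_funN.
  by apply/funext => x; rewrite cImJ.
- apply: eq_integrable01 i => x _.
  by rewrite !sqr_normcE cReJ cImJ sqrrN.
Qed.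

Lemma L2_cst c : L2 (fun=> c).
Proof.
split; [exact: measurable_cst|exact: measurable_cst|exact: integrable01_cst].
Qed.

(** The weight |f|^2 + |g|^2 dominates every term of a product f g and, up to
    the factor 2, |f + g|^2; both closure properties of L^2 come from it. *)
Lemma integrable01_dominated (h : R -> R) f g : L2 f -> L2 g ->
  measurable_fun I01 h ->
  (forall x, `|h x| <= Normc.normc (f x) ^+ 2 + Normc.normc (g x) ^+ 2) ->
  integrable01 h.
Proof.
move=> [_ _ fi] [_ _ gi] mh hle.
have fgi := integrable01D _ _ fi gi.
apply: (le_integrable _ _ _ fgi) => //=.
  exact/measurable_EFinP.
move=> x _; rewrite lee_fin; apply: (le_trans (hle x)).
exact: ler_norm.
Qed.

Lemma dot_le_sqr (p q r s : R) :
  `|p * q + r * s| <= p ^+ 2 + r ^+ 2 + (q ^+ 2 + s ^+ 2).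
Proof.
have := (sqr_ge0 (p - q), sqr_ge0 (p + q), sqr_ge0 (r - s), sqr_ge0 (r + s)).
move=> [[[h1 h2] h3] h4]; rewrite ler_norml; apply/andP; split; nra.
Qed.

Lemma L2N f : L2 f -> L2 (fun x => - f x).
Proof.
move=> [m1 m2 i]; split.
- rewrite (_ : (fun x => _) = (fun x => - complex.Re (f x))).
    exact: measurable_funN.
  by apply/funext => x; case: (f x).
- rewrite (_ : (fun x => _) = (fun x => - complex.Im (f x))).
    exact: measurable_funN.
  by apply/funext => x; case: (f x).
- apply: eq_integrable01 i => x _.
  by rewrite !sqr_normcE; case: (f x) => p q; rewrite /= !sqrrN.
Qed.

Lemma L2D f g : L2 f -> L2 g -> L2 (fun x => f x + g x).
Proof.
move=> Lf Lg; have [f1 f2 _] := Lf; have [g1 g2 _] := Lg.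
have m1 : measurable_fun I01 (fun x => complex.Re (f x + g x)).
  rewrite (_ : (fun x => _) = (fun x => complex.Re (f x) + complex.Re (g x))).
    exact: measurable_funD.
  by apply/funext => x; rewrite cReD.
have m2 : measurable_fun I01 (fun x => complex.Im (f x + g x)).
  rewrite (_ : (fun x => _) = (fun x => complex.Im (f x) + complex.Im (g x))).
    exact: measurable_funD.
  by apply/funext => x; rewrite cImD.
split => //.
have hi : integrable01 (fun x => 2^-1 * Normc.normc (f x + g x) ^+ 2).
  apply: (integrable01_dominated _ _ _ Lf Lg) => [|x].
    rewrite (_ : (fun x => _) = (fun x => 2^-1 *
      (complex.Re (f x + g x) ^+ 2 + complex.Im (f x + g x) ^+ 2))).
      by apply: measurable_funM => //; apply: measurable_funD;
        exact: measurable_funX.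
    by apply/funext => x; rewrite sqr_normcE.
  rewrite ger0_norm; last by rewrite mulr_ge0 ?sqr_ge0 ?invr_ge0.
  rewrite !sqr_normcE cReD cImD.
  have := sqr_ge0 (complex.Re (f x) - complex.Re (g x)).
  have := sqr_ge0 (complex.Im (f x) - complex.Im (g x)).
  nra.
apply: eq_integrable01 (integrable01Z 2 _ hi) => x _.
by rewrite mulrA mulfV ?mul1r// pnatr_eq0.
Qed.

Lemma L2B f g : L2 f -> L2 g -> L2 (fun x => f x - g x).
Proof. by move=> Lf Lg; apply: L2D => //; exact: L2N. Qed.

Lemma cintegrable01_L2M f g : L2 f -> L2 g ->
  cintegrable01 (fun x => f x * g x).
Proof.
move=> Lf Lg; have [f1 f2 _] := Lf; have [g1 g2 _] := Lg.
split; apply: (integrable01_dominated _ _ _ Lf Lg).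
- rewrite (_ : (fun x => _) = (fun x => complex.Re (f x) * complex.Re (g x) -
      complex.Im (f x) * complex.Im (g x))).
    by apply: measurable_funB; apply: measurable_funM.
  by apply/funext => x; rewrite cReM.
- move=> x; rewrite cReM !sqr_normcE -mulrN -(sqrrN (complex.Im (g x))).
  exact: dot_le_sqr.
- rewrite (_ : (fun x => _) = (fun x => complex.Re (f x) * complex.Im (g x) +
      complex.Im (f x) * complex.Re (g x))).
    by apply: measurable_funD; apply: measurable_funM.
  by apply/funext => x; rewrite cImM.
- move=> x; rewrite cImM !sqr_normcE [X in _ <= _ + X]addrC.
  exact: dot_le_sqr.
Qed.

Lemma cintegrable01_L2 f : L2 f -> cintegrable01 f.
Proof.
move=> /(cintegrable01_L2M _ _ (L2_cst 1)); apply: eq_cintegrable01 => x _.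
by rewrite mul1r.
Qed.

(** * Absolute continuity and Green's identity *)

(** [u1] is the density of [u]; [H2_rep v v1 v2] says this of the pairs (v, v1)
    and (v1, v2) on [0, 1]. *)
Definition abs_continuous u u1 : Prop := cintegrable01 u1 /\
  forall x, 0 <= x <= 1 -> u x = u 0 + cintegral `[0, x] u1.

Lemma abs_continuousM_integrable u u1 g : abs_continuous u u1 ->
  cintegrable01 g -> cintegrable01 (fun x => u x * g x).
Proof.
move=> [u1i uE] gi.
apply: eq_cintegrable01 (cintegrable01D _ _ (cintegrable01Z (u 0) _ gi)
  (cintegrable01_primitiveM _ _ u1i gi)) => x; rewrite in_itv/= => x01.
by rewrite -mulrDl -uE.
Qed.

Lemma abs_continuous_integrable u u1 : abs_continuous u u1 -> cintegrable01 u.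
Proof.
move=> /abs_continuousM_integrable /(_ (cintegrable01_cst 1)).
by apply: eq_cintegrable01 => x _; rewrite mulr1.
Qed.

Lemma abs_continuous_conj u u1 : abs_continuous u u1 ->
  abs_continuous (fun x => (u x)^*) (fun x => (u1 x)^*).
Proof.
move=> [u1i uE]; split; first exact: cintegrable01J.
by move=> x x01; rewrite cintegralJ// -rmorphD -uE.
Qed.

(** u is integrable against any integrable function, in particular against its
    own conjugate. *)
Lemma abs_continuous_L2 u u1 : abs_continuous u u1 -> L2 u.
Proof.
move=> uac; have ui := abs_continuous_integrable _ _ uac.
have [uui _] := abs_continuousM_integrable _ _ _ uac (cintegrable01J _ ui).
case: ui => /integrable01_measurable m1 /integrable01_measurable m2.
split => //.
apply: eq_integrable01 uui => x _.
by rewrite sqr_normcE cReM cReJ cImJ mulrN opprK.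
Qed.

Lemma abs_continuousB u u1 v v1 : abs_continuous u u1 -> abs_continuous v v1 ->
  abs_continuous (fun x => u x - v x) (fun x => u1 x - v1 x).
Proof.
move=> [u1i uE] [v1i vE]; have Nv1i := cintegrable01N _ v1i.
split=> [|x x01]; first exact: cintegrable01D.
by rewrite cintegralD// cintegralN// (uE x)// (vE x)//; ring.
Qed.

Lemma abs_continuous_by_parts u u1 v v1 :
  abs_continuous u u1 -> abs_continuous v v1 ->
  cintegral I01 (fun x => u x * v1 x) + cintegral I01 (fun x => v x * u1 x) =
  u 1 * v 1 - u 0 * v 0.
Proof.
move=> [u1i uE] [v1i vE].
have split_cint w w1 z : (forall x, 0 <= x <= 1 ->
      w x = w 0 + cintegral `[0, x] w1) ->
    cintegrable01 w1 -> cintegrable01 z ->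
    cintegral I01 (fun x => w x * z x) =
    w 0 * cintegral I01 z + cintegral I01 (fun x => cintegral `[0, x] w1 * z x).
  move=> wE wi zi; rewrite -cintegralZ//; last exact: in01_1.
  rewrite -cintegralD//; [|exact: in01_1|exact: cintegrable01Z
                         |exact: cintegrable01_primitiveM].
  apply: eq_cintegral; first exact: in01_1.
  by move=> x; rewrite in_itv/= => x01; rewrite -mulrDl -wE.
rewrite (split_cint u u1 v1)// (split_cint v v1 u1)//.
rewrite addrACA cintegral_primitive_by_parts//.
by rewrite (uE 1 in01_1) (vE 1 in01_1); ring.
Qed.

(** Integrating by parts the pairs (u, v1) and (v, u1) produces the same
    integral of u1 * v1, which cancels in the difference. *)
Lemma green_identity u u1 u2 v v1 v2 :
  abs_continuous u u1 -> abs_continuous u1 u2 ->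
  abs_continuous v v1 -> abs_continuous v1 v2 ->
  cintegral I01 (fun x => u x * v2 x) - cintegral I01 (fun x => v x * u2 x) =
  (u 1 * v1 1 - u 0 * v1 0) - (v 1 * u1 1 - v 0 * u1 0).
Proof.
move=> uac u1ac vac v1ac.
rewrite -(abs_continuous_by_parts _ _ _ _ uac v1ac).
rewrite -(abs_continuous_by_parts _ _ _ _ vac u1ac).
have -> : (fun x => v1 x * u1 x) = (fun x => u1 x * v1 x).
  by apply/funext => x; rewrite mulrC.
ring.
Qed.

Lemma H2_rep_abs_continuous v v1 v2 : H2_rep v v1 v2 ->
  abs_continuous v v1 /\ abs_continuous v1 v2.
Proof.
move=> [/cintegrable01_L2 v2i vE].
have v1ac : abs_continuous v1 v2 by split => // x /vE[].
split => //; split => [|x /vE[]//].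
exact: abs_continuous_integrable v1ac.
Qed.

(** * Symmetry of the realizations of -d^2/dx^2 *)

Lemma eqL2M f f' g g' : eqL2 f f' -> eqL2 g g' ->
  eqL2 (fun x => f x * g x) (fun x => f' x * g' x).
Proof.
rewrite /eqL2 /ae_eq; apply: filterS2 => x ff gg x01.
by rewrite ff ?gg.
Qed.

Lemma eqL2J f f' : eqL2 f f' -> eqL2 (fun x => (f x)^*) (fun x => (f' x)^*).
Proof.
by rewrite /eqL2 /ae_eq; apply: filterS => x ff x01; rewrite ff.
Qed.

Lemma inner_eqL2 f f' g g' : L2 f -> L2 f' -> L2 g -> L2 g' ->
  eqL2 f f' -> eqL2 g g' -> inner f g = inner f' g'.
Proof.
move=> Lf Lf' Lg Lg' ff gg; apply: ae_eq_cintegral; first exact: in01_1.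
- by apply: cintegrable01_L2M => //; exact: L2_conj.
- by apply: cintegrable01_L2M => //; exact: L2_conj.
- by apply: eqL2M => //; exact: eqL2J.
Qed.

Lemma innerDl f g h : L2 f -> L2 g -> L2 h ->
  inner (fun x => f x + g x) h = inner f h + inner g h.
Proof.
move=> Lf Lg Lh; rewrite /inner -cintegralD; first last.
- by apply: cintegrable01_L2M => //; exact: L2_conj.
- by apply: cintegrable01_L2M => //; exact: L2_conj.
- exact: in01_1.
by congr cintegral; apply/funext => x; rewrite mulrDl.
Qed.

Lemma innerNl f h : L2 f -> L2 h ->
  inner (fun x => - f x) h = - inner f h.
Proof.
move=> Lf Lh; rewrite /inner -cintegralN; first last.
- by apply: cintegrable01_L2M => //; exact: L2_conj.
- exact: in01_1.
by congr cintegral; apply/funext => x; rewrite mulNr.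
Qed.

Lemma innerJ f g : L2 f -> L2 g -> (inner f g)^* = inner g f.
Proof.
move=> Lf Lg; rewrite /inner -cintegralJ; first last.
- by apply: cintegrable01_L2M => //; exact: L2_conj.
- exact: in01_1.
by congr cintegral; apply/funext => x; rewrite rmorphM /= conjcK mulrC.
Qed.

Lemma innerDr f g h : L2 f -> L2 g -> L2 h ->
  inner h (fun x => f x + g x) = inner h f + inner h g.
Proof.
move=> Lf Lg Lh; rewrite /inner -cintegralD; first last.
- by apply: cintegrable01_L2M => //; exact: L2_conj.
- by apply: cintegrable01_L2M => //; exact: L2_conj.
- exact: in01_1.
by congr cintegral; apply/funext => x; rewrite rmorphD mulrDr.
Qed.

Lemma innerNr f h : L2 f -> L2 h ->
  inner h (fun x => - f x) = - inner h f.
Proof.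
move=> Lf Lh; rewrite /inner -cintegralN; first last.
- by apply: cintegrable01_L2M => //; exact: L2_conj.
- exact: in01_1.
by congr cintegral; apply/funext => x; rewrite rmorphN mulrN.
Qed.

(** The boundary conditions make the boundary terms of Green's identity for
    (v, conj z) cancel: the coefficient matrix is antisymmetric off the diagonal
    and the two endpoints enter with opposite signs. *)
Lemma graphA_symmetric (al be de : R) u g v h :
  graphA al be de u g -> graphA al be de v h -> inner u h = inner g v.
Proof.
move=> [Lu Lg [p [p1 [p2 [pH [p0 p1'] up gp]]]]].
move=> [Lv Lh [q [q1 [q2 [qH [q0 q1'] vq hq]]]]].
have [pac p1ac] := H2_rep_abs_continuous _ _ _ pH.
have [qac q1ac] := H2_rep_abs_continuous _ _ _ qH.
have Lp := abs_continuous_L2 _ _ pac.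
have Lq := abs_continuous_L2 _ _ qac.
have [[Lp2 _] [Lq2 _]] := (pH, qH).
rewrite (inner_eqL2 u p h (fun x => - q2 x))//; last exact: L2N.
rewrite (inner_eqL2 g (fun x => - p2 x) v q)//; last exact: L2N.
rewrite innerNl//.
rewrite innerNr//.
congr (- _); apply/eqP; rewrite -subr_eq0; apply/eqP.
have := green_identity _ _ _ _ _ _ pac p1ac
  (abs_continuous_conj _ _ qac) (abs_continuous_conj _ _ q1ac).
rewrite /inner.
have -> : (fun x => (q x)^* * p2 x) = (fun x => p2 x * (q x)^*).
  by apply/funext => x; rewrite mulrC.
move=> ->; rewrite p0 p1' q0 q1' !(rmorphD, rmorphM, rmorphN) /= ?oppr0.
rewrite -[al +i* 0]/(al%:C) -[be +i* 0]/(be%:C) -[de +i* 0]/(de%:C).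
ring.
Qed.

(** * The operator K as the inverse of a realization *)

Lemma integrable01_step x (f : R -> R) : integrable01 f ->
  integrable01 (fun y => (y <= x)%R%:R * f y).
Proof.
move=> /integrable01_restrict fi; apply/integrable01_restrict.
have mle : measurable_fun setT (fun y : measurableTypeR R => y <= x).
  exact: measurable_fun_ler.
have := integrable_bool _ _ _ mle fi.
apply: eq_integrable => // y _ /=; congr EFin.
by rewrite /patch; case: ifP => _; rewrite ?mul0r 1?mulrC.
Qed.

Lemma cintegrable01_step x f : cintegrable01 f ->
  cintegrable01 (fun y => (y <= x)%R%:R * f y).
Proof.
move=> [f1 f2]; split.
- apply: eq_integrable01 (integrable01_step x _ f1) => y _.
  by case: leP => _; rewrite ?mul1r ?mul0r.
- apply: eq_integrable01 (integrable01_step x _ f2) => y _.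
  by case: leP => _; rewrite ?mul1r ?mul0r.
Qed.

Lemma cintegral_step x t f : 0 <= x -> 0 <= t ->
  cintegral `[0, t] (fun y => (y <= x)%R%:R * f y) =
  cintegral `[0, Num.min t x] f.
Proof.
move=> x0 t0; congr (_ +i* _);
  rewrite [LHS]Rintegral_mkcond [RHS]Rintegral_mkcond.
- apply: eq_Rintegral => y _; rewrite /patch !mem_setE !in_itv/= le_min.
  by case: (0 <= y); case: (y <= t); case: (y <= x); rewrite /= ?mul1r ?mul0r.
- apply: eq_Rintegral => y _; rewrite /patch !mem_setE !in_itv/= le_min.
  by case: (0 <= y); case: (y <= t); case: (y <= x); rewrite /= ?mul1r ?mul0r.
Qed.

Lemma cintegrable01_minM x f : 0 <= x <= 1 -> cintegrable01 f ->
  cintegrable01 (fun y => (Num.min y x)%:C * f y).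
Proof.
move=> /andP[x0 x1] fi.
have si := cintegrable01_step x _ (cintegrable01_cst 1).
apply: eq_cintegrable01 (cintegrable01_primitiveM _ _ si fi) => y.
rewrite in_itv/= => /andP[y0 y1].
by rewrite cintegral_step// cintegral_cst ?le_min ?y0// mulr1.
Qed.

(** Integration by parts against the step function of [0, x], whose primitive
    is y |-> min (y, x), reduces the integral over [0, x] to one over [0, 1]. *)
Lemma iterated_primitive x f : 0 <= x <= 1 -> cintegrable01 f ->
  cintegral `[0, x] (fun t => cintegral `[0, t] f) =
  x%:C * cintegral I01 f - cintegral I01 (fun y => (Num.min y x)%:C * f y).
Proof.
move=> /andP[x0 x1] fi.
have si := cintegrable01_step x _ (cintegrable01_cst 1).
have := cintegral_primitive_by_parts _ _ fi si.
rewrite cintegral_step// min_r// cintegral_cst// mulr1 mulrC => <-.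
have -> : cintegral I01 (fun y => (Num.min y x)%:C * f y) = cintegral I01
    (fun t => cintegral `[0, t] (fun y => (y <= x)%R%:R * 1) * f t).
  apply: eq_cintegral; first exact: in01_1.
  move=> y; rewrite in_itv/= => /andP[y0 y1].
  by rewrite cintegral_step// cintegral_cst ?le_min ?y0// mulr1.
rewrite addrK -[x in LHS](min_r x1) -cintegral_step//.
by congr cintegral; apply/funext => y; rewrite mulr1 mulrC.
Qed.

(** Uses |x - y| = x + y - 2 min (y, x). *)
Lemma calKE x f : 0 <= x <= 1 -> cintegrable01 f ->
  calK f x = calK f 0 - 2^-1 * (x%:C * cintegral I01 f) +
    cintegral I01 (fun y => (Num.min y x)%:C * f y).
Proof.
move=> x01 fi; have mi := cintegrable01_minM _ _ x01 fi.
have yi := cintegrable01_minM _ _ in01_1 fi.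
have d0 : cintegral I01 (fun y => `|0 - y|%:C * f y) =
    cintegral I01 (fun y => (Num.min y 1)%:C * f y).
  apply: eq_cintegral; first exact: in01_1.
  move=> y; rewrite in_itv/= => /andP[y0 y1].
  by rewrite sub0r normrN ger0_norm// min_l.
have dx : cintegral I01 (fun y => `|x - y|%:C * f y) =
    cintegral I01 (fun y => x%:C * f y + ((Num.min y 1)%:C * f y +
      (- 2) * ((Num.min y x)%:C * f y))).
  apply: eq_cintegral; first exact: in01_1.
  move=> y; rewrite in_itv/= => /andP[y0 y1].
  rewrite (min_l y1) mulrA -!mulrDl; congr (_ * _).
  have [yx|xy] := leP y x.
    by rewrite ger0_norm ?subr_ge0// rmorphB; ring.
  by rewrite ltr0_norm ?subr_lt0// opprB rmorphB; ring.
rewrite /calK dx d0 !cintegralD ?cintegralZ//; try exact: in01_1;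
  try exact: cintegrable01Z; try exact: mi; try exact: fi.
  by field.
by apply: cintegrable01D => //; exact: cintegrable01Z.
Qed.

Lemma H2_rep_calK f : L2 f ->
  H2_rep (calK f)
    (fun x => 2^-1 * cintegral I01 f - cintegral `[0, x] f) (fun x => - f x).
Proof.
move=> Lf; have fi := cintegrable01_L2 _ Lf.
split; first exact: L2N.
move=> x x01; split; last by rewrite cintegral0 subr0 cintegralN.
have pi : cintegrable01 (fun x => cintegral `[0, x] f).
  apply: eq_cintegrable01
    (cintegrable01_primitiveM _ _ fi (cintegrable01_cst 1)).
  by move=> y _; rewrite mulr1.
rewrite cintegralD//; [|exact: cintegrable01_cst|exact: cintegrable01N].
rewrite cintegralN// iterated_primitive// cintegral_cst; last by case/andP: x01.
by rewrite (calKE x)//; field.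
Qed.

(** For u = K f and F the integral of f over [0, 1]: u' 0 = F / 2,
    u' 1 = - F / 2 and u 0 + u 1 = - F / 2, so u' 0 = - (u 0 + u 1) and
    u' 1 = u 0 + u 1. *)
Lemma graphA_calK f : L2 f -> graphA (-1) (-1) 1 (calK f) f.
Proof.
move=> Lf; have fi := cintegrable01_L2 _ Lf.
have KH := H2_rep_calK _ Lf.
have [Kac _] := H2_rep_abs_continuous _ _ _ KH.
split; [exact: abs_continuous_L2 Kac|exact: Lf|].
exists (calK f), (fun x => 2^-1 * cintegral I01 f - cintegral `[0, x] f),
  (fun x => - f x).
have K1 : calK f 1 = - calK f 0 - 2^-1 * cintegral I01 f.
  rewrite calKE//; last exact: in01_1.
  have -> : cintegral I01 (fun y => (Num.min y 1)%:C * f y) = - 2 * calK f 0.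
    rewrite /calK mulrA mulrNN divff ?mul1r ?pnatr_eq0//.
    apply: eq_cintegral; first exact: in01_1.
    move=> y; rewrite in_itv/= => /andP[y0 y1].
    by rewrite sub0r normrN ger0_norm// min_l.
  by ring.
split => //.
- split; first by rewrite cintegral0 K1 rmorphN; ring.
  by rewrite K1 rmorphN; field.
- exact: ae_eq_refl.
- rewrite (_ : (fun x => - - f x) = f); first exact: ae_eq_refl.
  by apply/funext => x; rewrite opprK.
Qed.

(** * Polynomials on [0, 1] *)

Lemma integrable01_exp n : integrable01 (fun t : R => t ^+ n).
Proof.
apply: (@continuous_compact_integrable R (fun t => t ^+ n)).
  exact: segment_compact.
by apply: continuous_subspaceT => x; exact: exprn_continuous.
Qed.

Lemma primitive_exp n x : 0 <= x ->
  primitive (fun t : R => t ^+ n) x = x ^+ n.+1 / n.+1%:R.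
Proof.
rewrite le_eqVlt => /predU1P[<-|x0].
  by rewrite /primitive set_itv1 Rintegral_set1 expr0n mul0r.
pose F : R -> R := n.+1%:R^-1 \*: (@GRing.exp R ^~ n.+1).
have dF t : derivable F t 1 by apply: derivableZ; exact: exprn_derivable.
have cF : continuous F.
  by move=> t; apply: differentiable_continuous; exact/derivable1_diffP.
rewrite /primitive /Rintegral (@continuous_FTC2 _ _ F)//.
- by rewrite /F /= expr0n/= scaler0 subr0 [RHS]mulrC.
- by apply: continuous_subspaceT => t; exact: exprn_continuous.
- split => //.
  + exact/cvg_at_right_filter/cF.
  + exact/cvg_at_left_filter/cF.
- move=> t _.
  rewrite derive1E deriveZ ?exp_derive//; last exact: exprn_derivable.
  by rewrite [_%:A]mulr1 scalerA mulVf ?scale1r// pnatr_eq0.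
Qed.

Lemma cintegrable01_exp n : cintegrable01 (fun t : R => t%:C ^+ n).
Proof.
split; under eq_fun do rewrite -rmorphXn /=.
  exact: integrable01_exp.
exact: integrable01_cst.
Qed.

Lemma cintegral_exp n x : 0 <= x ->
  cintegral `[0, x] (fun t : R => t%:C ^+ n) = x%:C ^+ n.+1 / n.+1%:R.
Proof.
move=> x0; have -> : (fun t : R => t%:C ^+ n) = (fun t => (t ^+ n)%:C).
  by apply/funext => t; rewrite rmorphXn.
rewrite /cintegral/= -[X in X +i* _]/(primitive _ x) primitive_exp//.
rewrite Rintegral_cst// mul0r -[LHS]/((_ : R)%:C) rmorphM rmorphXn.
by rewrite fmorphV rmorph_nat.
Qed.

Lemma cintegrable01_sum (I : Type) (r : seq I) (F : I -> R -> C) :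
  (forall i, cintegrable01 (F i)) ->
  cintegrable01 (fun x => \sum_(i <- r) F i x).
Proof.
move=> Fi; elim: r => [|i r IH].
  by apply: eq_cintegrable01 (cintegrable01_cst 0) => x _; rewrite big_nil.
apply: eq_cintegrable01 (cintegrable01D _ _ (Fi i) IH) => x _.
by rewrite big_cons.
Qed.

Lemma cintegral_sum (I : Type) (r : seq I) (F : I -> R -> C) x :
  0 <= x <= 1 -> (forall i, cintegrable01 (F i)) ->
  cintegral `[0, x] (fun y => \sum_(i <- r) F i y) =
  \sum_(i <- r) cintegral `[0, x] (F i).
Proof.
move=> x01 Fi; elim: r => [|i r IH].
  rewrite big_nil (eq_cintegral _ (fun=> 0) x x01) => [|y _].
    by rewrite cintegral_cst ?mulr0//; case/andP: x01.
  by rewrite big_nil.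
rewrite (eq_cintegral _ (fun y => F i y + \sum_(j <- r) F j y) x x01).
  by rewrite big_cons cintegralD// ?IH//; exact: cintegrable01_sum.
by move=> y _; rewrite big_cons.
Qed.

(** The coefficient at i = 0 is [p`_0 / 0], that is 0, so this is the primitive
    vanishing at 0. *)
Definition poly_primitive p : {poly C} :=
  \poly_(i < (size p).+1) (p`_i.-1 / i%:R).

Lemma cintegrable01_poly p : cintegrable01 (fun x => p.[x%:C]).
Proof.
have := cintegrable01_sum _ (index_enum _)
  (fun (i : 'I_(size p)) t => p`_i * t%:C ^+ i)
  (fun i => cintegrable01Z _ _ (cintegrable01_exp i)).
by apply: eq_cintegrable01 => x _; rewrite horner_coef.
Qed.

Lemma cintegral_poly p x : 0 <= x <= 1 ->
  cintegral `[0, x] (fun t => p.[t%:C]) = (poly_primitive p).[x%:C].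
Proof.
move=> x01.
rewrite (eq_cintegral _ (fun t => \sum_(i < size p) p`_i * t%:C ^+ i) x x01);
  last by move=> t _; rewrite horner_coef.
rewrite cintegral_sum//; last first.
  by move=> i; exact/cintegrable01Z/cintegrable01_exp.
rewrite horner_poly big_ord_recl/= invr0 mulr0 mul0r add0r.
apply: eq_bigr => i _; rewrite cintegralZ//; last exact: cintegrable01_exp.
by rewrite cintegral_exp; [rewrite mulrA mulrAC|case/andP: x01].
Qed.

Lemma poly_primitive_deriv p : (p`_0)%:P + poly_primitive p^`() = p.
Proof.
apply/polyP => -[|i]; rewrite coefD coefC coef_poly/=.
  by rewrite invr0 mulr0 addr0.
rewrite add0r ltnS; case: ltnP => [_|/(nth_default 0)/eqP].
  by rewrite coef_deriv -(mulr_natr p`_i.+1) mulfK// pnatr_eq0.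
by rewrite -/(_`_i) coef_deriv mulrn_eq0/= => /eqP.
Qed.

Lemma abs_continuous_poly p :
  abs_continuous (fun x => p.[x%:C]) (fun x => p^`().[x%:C]).
Proof.
split=> [|x x01]; first exact: cintegrable01_poly.
rewrite cintegral_poly// -[in LHS](poly_primitive_deriv p).
by rewrite hornerD hornerC horner_coef0.
Qed.

(** One integration raises the degree by one and turns equality almost
    everywhere into equality on [0, 1]. *)
Lemma abs_continuous_eq_poly u u1 p : abs_continuous u u1 ->
  eqL2 u1 (fun x => p.[x%:C]) ->
  exists2 q : {poly C}, (size q <= (size p).+1)%N &
    forall x, 0 <= x <= 1 -> u x = q.[x%:C].
Proof.
move=> [u1i uE] u1p; exists ((u 0)%:P + poly_primitive p).
  rewrite (leq_trans (size_polyD _ _))// geq_max.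
  by rewrite (leq_trans (size_polyC_leq1 _))// size_poly.
move=> x x01; rewrite uE// hornerD hornerC -cintegral_poly//.
by congr (_ + _); apply: ae_eq_cintegral => //; exact: cintegrable01_poly.
Qed.

(** * Cubics dual to the monomials *)

Section HilbertMatrix.
Context {F : numFieldType}.

(** Inverse of the 4 x 4 Hilbert matrix 1 / (j + k + 1), the Gram matrix of the
    monomials 1, x, x^2, x^3 in L^2(0, 1). *)
Definition hilbert4_inv (i j : 'I_4) : F :=
  nth 0 (nth [::] [::
    [::   16;  - 120;    240;  - 140];
    [:: - 120;  1200;  - 2700;   1680];
    [::   240; - 2700;   6480;  - 4200];
    [:: - 140;  1680;  - 4200;   2800]] i) j.

Lemma hilbert4_invP (i k : 'I_4) :
  \sum_(j < 4) hilbert4_inv i j / (j + k).+1%:R = (i == k)%:R.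
Proof.
rewrite !big_ord_recl big_ord0 /hilbert4_inv.
case: i k => [[|[|[|[|//]]]]] ? [[|[|[|[|//]]]]] ? /=;
  by rewrite /bump /=; field.
Qed.

End HilbertMatrix.

Definition dual_monomial (i : 'I_4) : {poly C} :=
  \sum_(j < 4) (hilbert4_inv i j)%:C *: 'X^j.

Lemma L2_poly p : L2 (fun x : R => p.[x%:C]).
Proof. exact: abs_continuous_L2 (abs_continuous_poly p). Qed.

Lemma dual_monomial_conj i (x : R) :
  ((dual_monomial i).[x%:C])^* = (dual_monomial i).[x%:C].
Proof.
rewrite /dual_monomial horner_sum rmorph_sum; apply: eq_bigr => j _ /=.
rewrite hornerZ hornerXn; set z := hilbert4_inv i j.
by rewrite -rmorphXn -rmorphM; exact: conjc_real.
Qed.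

(** Pairing with the dual basis reads off the coefficients of a cubic. *)
Lemma inner_dual_monomial p (i : 'I_4) : (size p <= 4)%N ->
  inner (fun x => p.[x%:C]) (fun x => (dual_monomial i).[x%:C]) = p`_i.
Proof.
move=> sp; rewrite /inner.
rewrite (eq_cintegral _ (fun x => \sum_(k < 4) p`_k *
  (\sum_(j < 4) (hilbert4_inv i j)%:C * x%:C ^+ (j + k))) 1 in01_1); last first.
  move=> x _; rewrite dual_monomial_conj (horner_coef_wide _ sp) mulr_suml.
  apply: eq_bigr => k _; rewrite -mulrA; congr (_ * _).
  rewrite /dual_monomial horner_sum mulr_sumr; apply: eq_bigr => j _.
  by rewrite hornerZ hornerXn exprD; ring.
have ei (j k : 'I_4) := cintegrable01Z (hilbert4_inv i j)%:C _
  (cintegrable01_exp (j + k)).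
have si (k : 'I_4) := cintegrable01_sum _ (index_enum 'I_4) _ (ei^~ k).
rewrite cintegral_sum//; [|exact: in01_1|by move=> k; exact: cintegrable01Z].
rewrite (eq_bigr (fun k : 'I_4 => p`_k * (i == k)%:R)); last first.
  move=> k _; rewrite cintegralZ//; last exact: in01_1.
  congr (_ * _); rewrite cintegral_sum//; last exact: in01_1.
  have -> : (i == k)%:R = ((i == k)%:R : R)%:C by rewrite rmorph_nat.
  rewrite -hilbert4_invP rmorph_sum; apply: eq_bigr => j _.
  rewrite cintegralZ; [|exact: in01_1|exact: cintegrable01_exp].
  by rewrite cintegral_exp// expr1n mul1r rmorphM fmorphV rmorph_nat.
rewrite (bigD1 i)//= eqxx mulr1 big1 ?addr0// => k.
by rewrite eq_sym => /negPf ->; rewrite mulr0.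
Qed.

(** * The perturbation *)

Lemma kerA_affine (al be de : R) u : kerA al be de u ->
  exists2 p : {poly C}, (size p <= 2)%N & eqL2 u (fun x => p.[x%:C]).
Proof.
move=> [_ _ [v [v1 [v2 [vH _ uv v20]]]]].
have [vac v1ac] := H2_rep_abs_continuous _ _ _ vH.
have v2p : eqL2 v2 (fun x => (0 : {poly C}).[x%:C]).
  move: v20; rewrite /eqL2 /ae_eq; apply: filterS => x + x01 => /(_ x01) v2x.
  by rewrite horner0 -[v2 x]opprK -v2x oppr0.
have [p1 sp1 v1E] := abs_continuous_eq_poly _ _ _ v1ac v2p.
have v1p : eqL2 v1 (fun x => p1.[x%:C]).
  by apply: aeW => x; rewrite /= in_itv; exact: v1E.
have [p sp vE] := abs_continuous_eq_poly _ _ _ vac v1p.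
exists p; first by rewrite (leq_trans sp)// ltnS (leq_trans sp1)// size_poly0.
apply: ae_eq_trans uv _.
by apply: aeW => x; rewrite /= in_itv; exact: vE.
Qed.

(** The difference of the two representatives has second derivative h - g, and
    is recovered from it by two integrations.  It is applied to u = K f and
    w = S f, whose boundary conditions need not agree. *)
Lemma graphA_sub_poly (a1 b1 d1 a2 b2 d2 : R) u g w h p :
  graphA a1 b1 d1 u g -> graphA a2 b2 d2 w h ->
  eqL2 (fun x => g x - h x) (fun x => p.[x%:C]) ->
  exists2 q : {poly C}, (size q <= (size p).+2)%N &
    eqL2 (fun x => u x - w x) (fun x => q.[x%:C]).
Proof.
move=> [_ _ [v [v1 [v2 [vH _ uv gv2]]]]] [_ _ [z [z1 [z2 [zH _ wz hz2]]]]] ghp.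
have [vac v1ac] := H2_rep_abs_continuous _ _ _ vH.
have [zac z1ac] := H2_rep_abs_continuous _ _ _ zH.
have ac := abs_continuousB _ _ _ _ vac zac.
have ac1 := abs_continuousB _ _ _ _ v1ac z1ac.
have e2 : eqL2 (fun x => v2 x - z2 x) (fun x => (- p).[x%:C]).
  move: gv2 hz2 ghp; rewrite /eqL2 /ae_eq; apply: filterS3.
  move=> x + + + x01 => /(_ x01) gE /(_ x01) hE /(_ x01) pE.
  by rewrite hornerN -pE gE hE; ring.
have [q1 sq1 E1] := abs_continuous_eq_poly _ _ _ ac1 e2.
have e1 : eqL2 (fun x => v1 x - z1 x) (fun x => q1.[x%:C]).
  by apply: aeW => x; rewrite /= in_itv; exact: E1.
have [q sq E] := abs_continuous_eq_poly _ _ _ ac e1.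
exists q; first by rewrite (leq_trans sq)// ltnS (leq_trans sq1)// size_polyN.
move: uv wz; rewrite /eqL2 /ae_eq; apply: filterS2.
move=> x + + x01 => /(_ x01) uE /(_ x01) wE.
by rewrite uE wE E//; move: x01; rewrite /= in_itv.
Qed.

Section GreenOperator.
Context (alpha beta delta : R) (S : (R -> C) -> (R -> C)).
Hypothesis greenS : green_operator alpha beta delta S.

(** P S = 0 says that the range of S is orthogonal to ker A, so f and g may be
    replaced by f - P f = A S f and g - P g = A S g, and A is symmetric. *)
Lemma green_operator_symmetric f g : L2 f -> L2 g ->
  inner (S f) g = inner f (S g).
Proof.
move=> Lf Lg; have [[SL2 _ _ _] [P [projP PS]]] := greenS.
have [fA _ PSf] := PS f Lf; have [gA _ PSg] := PS g Lg.
have [LSf Lf' _] := fA; have [LSg Lg' _] := gA.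
have [VPf _] := projP f Lf; have [VPg _] := projP g Lg.
have [LPf _ _] := VPf; have [LPg _ _] := VPg.
have orth u k : L2 u -> L2 (P u) -> eqL2 (P u) (fun=> 0) ->
    kerA alpha beta delta k -> L2 k -> inner u k = 0.
  move=> Lu LPu Pu0 kA Lk; have [_ /(_ k kA) <-] := projP u Lu.
  apply: inner_eqL2 => //; [exact: L2B| |exact: ae_eq_refl].
  move: Pu0; rewrite /eqL2 /ae_eq; apply: filterS => x + x01 => /(_ x01) ->.
  by rewrite subr0.
have [VPSf _] := projP _ LSf; have [LPSf _ _] := VPSf.
have [VPSg _] := projP _ LSg; have [LPSg _ _] := VPSg.
have -> : inner (S f) g = inner (S f) (fun x => g x - P g x).
  have {1}-> : g = (fun x => (g x - P g x) + P g x).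
    by apply/funext => x; rewrite subrK.
  by rewrite innerDr// (orth _ (P g))// addr0.
have -> : inner f (S g) = inner (fun x => f x - P f x) (S g).
  have {1}-> : f = (fun x => (f x - P f x) + P f x).
    by apply/funext => x; rewrite subrK.
  by rewrite innerDl// -(innerJ (S g) (P f))// (orth _ (P f))// conjc0 addr0.
exact: graphA_symmetric fA gA.
Qed.

Let T f x := calK f x - S f x.

Lemma perturbation_symmetric f g : L2 f -> L2 g ->
  inner (T f) g = inner f (T g).
Proof.
move=> Lf Lg; have [[SL2 _ _ _] _] := greenS.
have KL2 h : L2 h -> L2 (calK h) by move=> /graphA_calK[].
rewrite /T innerDl ?innerDr ?innerNl ?innerNr//;
  try by [exact: SL2|exact: KL2|apply: L2N; exact: SL2].
rewrite green_operator_symmetric//; congr (_ + _).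
exact: graphA_symmetric (graphA_calK _ Lf) (graphA_calK _ Lg).
Qed.

Lemma perturbation_L2 f : L2 f -> L2 (T f).
Proof.
move=> Lf; have [[SL2 _ _ _] _] := greenS.
by apply: L2B; [case: (graphA_calK _ Lf)|exact: SL2].
Qed.

Lemma perturbation_cubic f : L2 f ->
  exists2 p : {poly C}, (size p <= 4)%N & eqL2 (T f) (fun x => p.[x%:C]).
Proof.
move=> Lf; have [_ [P [projP PS]]] := greenS.
have [fA _ _] := PS f Lf; have [VPf _] := projP f Lf.
have [p sp Pfp] := kerA_affine _ _ _ _ VPf.
have e : eqL2 (fun x => f x - (f x - P f x)) (fun x => p.[x%:C]).
  move: Pfp; rewrite /eqL2 /ae_eq; apply: filterS => x + x01 => /(_ x01) <-.
  by rewrite subKr.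
have [q sq Tq] := graphA_sub_poly _ _ _ _ _ _ _ _ _ _ _ (graphA_calK _ Lf) fA e.
by exists q => //; rewrite (leq_trans sq)// !ltnS.
Qed.

Definition separated_kernel (q : 'I_4 -> {poly C}) (x y : R) : C :=
  \sum_(i < 4) x%:C ^+ i * ((q i).[y%:C])^*.

Lemma separated_kernel_polynomial (q : 'I_4 -> {poly C}) :
  polynomial_kernel (separated_kernel q).
Proof.
exists (\poly_(i < 4) map_poly conjc (q (inord i))) => x y.
rewrite horner_poly horner_sum; apply: eq_bigr => i _.
rewrite hornerM horner_exp hornerC mulrC inord_val; congr (_ * _).
by rewrite -[in RHS]conjc_real horner_map.
Qed.

Lemma integral_separated_kernel (q : 'I_4 -> {poly C}) f x : L2 f ->
  cintegral I01 (fun y => separated_kernel q x y * f y) =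
  \sum_(i < 4) x%:C ^+ i * inner f (fun y => (q i).[y%:C]).
Proof.
move=> Lf.
have qi (i : 'I_4) : cintegrable01 (fun y => f y * ((q i).[y%:C])^*).
  by apply: cintegrable01_L2M => //; apply: L2_conj; exact: L2_poly.
rewrite (eq_cintegral _ (fun y => \sum_(i < 4)
  x%:C ^+ i * (f y * ((q i).[y%:C])^*)) 1 in01_1); last first.
  move=> y _; rewrite /separated_kernel mulr_suml; apply: eq_bigr => i _; ring.
rewrite cintegral_sum; [|exact: in01_1|by move=> i; exact: cintegrable01Z].
by apply: eq_bigr => i _; rewrite cintegralZ//; exact: in01_1.
Qed.

(** The coefficients of the cubic T f are the pairings of T f with the dual
    basis; symmetry moves T onto the dual basis, where it gives cubics again. *)
Lemma perturbation_integral_kernel : exists k : R -> R -> C,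
  polynomial_kernel k /\ integral_operator k T.
Proof.
have /fin_all_exists2[q _ Tq] (i : 'I_4) :=
  perturbation_cubic _ (L2_poly (dual_monomial i)).
exists (separated_kernel q); split; first exact: separated_kernel_polynomial.
move=> f Lf; have [p sp Tfp] := perturbation_cubic _ Lf.
apply: (ae_eq_trans Tfp); apply: aeW => x _.
rewrite integral_separated_kernel// (horner_coef_wide _ sp).
apply: eq_bigr => i _; rewrite mulrC; congr (_ * _).
have LTf := perturbation_L2 _ Lf.
have Ld := L2_poly (dual_monomial i).
rewrite -(inner_dual_monomial _ _ sp).
transitivity (inner (T f) (fun x => (dual_monomial i).[x%:C])).
  apply: inner_eqL2 => //; [exact: L2_poly|exact: ae_eq_sym|exact: ae_eq_refl].
rewrite perturbation_symmetric//.
by apply: inner_eqL2 => //;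
  [exact: perturbation_L2|exact: L2_poly|exact: ae_eq_refl].
Qed.

Lemma perturbation_rank : rank_le T 4.
Proof.
exists (fun i x => x%:C ^+ i); split=> [i|f Lf].
  rewrite (_ : (fun x => _) = (fun x => 'X^i.[x%:C])); first exact: L2_poly.
  by apply/funext => x; rewrite hornerXn.
have [p sp Tfp] := perturbation_cubic _ Lf.
exists (fun i => p`_i); apply: ae_eq_trans Tfp _; apply: aeW => x _.
by rewrite (horner_coef_wide _ sp).
Qed.
End GreenOperator.

End Proofs.

Theorem mainTheorem1 (R : realType) (alpha beta delta : R)
    (KG : (R -> R[i]) -> (R -> R[i])) :
  beta != 0 ->
  green_operator alpha beta delta KG ->
  let T := fun (f : R -> R[i]) (x : R) => calK f x - KG f x in
  (exists k : R -> R -> R[i], polynomial_kernel k /\ integral_operator k T) /\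
  rank_le T 4.
Proof.
move=> _ greenKG T; split.
  exact: perturbation_integral_kernel greenKG.
exact: perturbation_rank greenKG.
Qed.
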